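(* Let $m_0\ge1$ and $\Lambda\ge1$ be constants, and let $s$ be a state with $m=m(s)\ge m_0$, $r=x_1/x_3\ge\Lambda$ and $|w_3|\le\sqrt T/r$. Then there is a candidate $s'$ of $s$, obtained by one $V$-move, with $$m(s')\le21.2\,\frac{m}{r}.$$ In particular, for $\gamma>1$, $m(s')\le m/\gamma$ whenever $r\ge21.2\,\gamma$.
   Context: $K$ is a cubic number field of signature $(1,1)$, with real embedding $\sigma_r$ and complex embedding $\sigma_c$; $L\subset\mathcal O_K$ is an order. A state is an ordered triple $s=(u_1,u_2,u_3)$ of elements of $L$ forming a $\mathbb Q$-basis of $K$ with $x_i=\sigma_r(u_i)>0$, sorted so that $x_1\ge x_2\ge x_3>0$. Put $\xi=(x_1,x_2,x_3)$, $\nu=(\sigma_c(u_1),\sigma_c(u_2),\sigma_c(u_3))$, $\bar\zeta=\langle\xi,\nu\rangle/|\xi|^2$ (bilinear dot product; the bar is part of the symbol), $w_i=\sigma_c(u_i)-\bar\zeta x_i$ (deviations), $T=\sum_i|w_i|^2$. With $a_\perp,b_\perp\in\mathbb R^3$ the real and imaginary parts of $(w_1,w_2,w_3)$, the conformal module is $m(s)=T/(2|a_\perp\times b_\perp|)$. For $A,B,g\in\mathbb Z_{\ge0}$ the move $V(A,B,g)$ sends $(u_1,u_2,u_3)$ to $(u_1-g(u_2-Bu_3)-Au_3,\ u_2-Bu_3,\ u_3)$; it gives a candidate (lies in the window) if all new real coordinates are positive, and the candidate is then re-sorted ($m$ does not depend on the ordering). *)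

(* Defs.v *)
From HB Require Import structures.
From mathcomp Require Import all_boot all_order all_algebra all_field.
From mathcomp Require Import reals complex.

Set Implicit Arguments.
Unset Strict Implicit.
Unset Printing Implicit Defensive.

Import Order.TTheory GRing.Theory Num.Theory.

Local Open Scope ring_scope.
Local Open Scope complex_scope.

Section NumberField.
Variables (R : realType) (K : fieldExtType rat).

Definition nonreal (f : K -> R[i]) : Prop := exists x, complex.Im (f x) != 0.

(* K has exactly r1 real embeddings and r2 conjugate pairs of non-real ones. *)
Definition has_signature (r1 r2 : nat) : Prop :=
  exists (rho : 'I_r1 -> {rmorphism K -> R})
         (tau : 'I_r2 -> {rmorphism K -> R[i]}),
    [/\ forall i j, rho i =1 rho j -> i = j,
        forall j, nonreal (tau j),
        forall i j,
          tau i =1 tau j \/ (forall x, tau i x = conjc (tau j x)) -> i = j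
      & forall f : {rmorphism K -> R[i]},
          (exists i, forall x, f x = (rho i x)%:C) \/
          (exists j, f =1 tau j \/ (forall x, f x = conjc (tau j x)))].

(* A subring of the ring of integers, free over Z of rank [K : Q]. *)
Definition is_order (L : {pred K}) : Prop :=
  [/\ GRing.subring_closed L,
      (forall x, x \in L -> integralOver (intr : int -> K) x)
    & exists b : (\dim {:K}).-tuple K,
        basis_of {:K} b /\
        (forall x, x \in L <->
           exists c : 'I_(\dim {:K}) -> int,
             x = \sum_(i < \dim {:K}) (c i)%:~R * tnth b i)].

End NumberField.

Section Vectors.

Definition dot (S : pzRingType) (n : nat) (u v : 'rV[S]_n) : S :=
  \sum_(i < n) u 0 i * v 0 i.

Definition enorm (R : realType) (n : nat) (u : 'rV[R]_n) : R :=
  Num.sqrt (dot u u).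

(* Index arithmetic in 'I_3 is modulo 3. *)
Definition cross (S : pzRingType) (u v : 'rV[S]_3) : 'rV[S]_3 :=
  \row_(k < 3) (u 0 (k + 1) * v 0 (k + 2) - u 0 (k + 2) * v 0 (k + 1)).

End Vectors.

(* Coordinates u_1, u_2, u_3 of a triple have indices 0, 1, 2. *)
Section States.
Variables (R : realType) (K : fieldExtType rat).
Variables (sr : {rmorphism K -> R}) (sc : {rmorphism K -> R[i]}).
Implicit Types s t : 3.-tuple K.

Definition xi s : 'rV[R]_3 := \row_(k < 3) sr (tnth s k).

Definition nu s : 'rV[R[i]]_3 := \row_(k < 3) sc (tnth s k).

Definition xiC s : 'rV[R[i]]_3 := map_mx (fun x : R => x%:C) (xi s).

Definition zetabar s : R[i] := dot (xiC s) (nu s) / (enorm (xi s) ^+ 2)%:C.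

Definition dev s : 'rV[R[i]]_3 := nu s - zetabar s *: xiC s.

Definition devT s : R := \sum_(k < 3) Normc.normc (dev s 0 k) ^+ 2.

Definition a_perp s : 'rV[R]_3 := map_mx (fun z : R[i] => complex.Re z) (dev s).

Definition b_perp s : 'rV[R]_3 := map_mx (fun z : R[i] => complex.Im z) (dev s).

Definition conf_module s : R :=
  devT s / (2 * enorm (cross (a_perp s) (b_perp s))).

Definition in_window t : Prop := forall k : 'I_3, 0 < sr (tnth t k).

Definition is_state (L : {pred K}) s : Prop :=
  [/\ forall k : 'I_3, tnth s k \in L,
      basis_of {:K} s,
      in_window s
    & forall i j : 'I_3, (i <= j)%N -> sr (tnth s j) <= sr (tnth s i)].

Definition Vmove (A B g : nat) s : 3.-tuple K :=
  let u1 := tnth s 0 in let u2 := tnth s 1 in let u3 := tnth s 2 in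
  let u2' := u2 - B%:R * u3 in
  [tuple u1 - g%:R * u2' - A%:R * u3; u2'; u3].

(* Real coordinates of a Q-basis are pairwise distinct, so s' is determined
   by the triple Vmove A B g s. *)
Definition V_candidate (L : {pred K}) s s' : Prop :=
  exists A B g : nat,
    [/\ in_window (Vmove A B g s), is_state L s' & perm_eq s' (Vmove A B g s)].

End States.

(* Main.v *)
Require Import Defs.
From mathcomp Require Import all_boot all_order all_fingroup all_algebra all_field.
From mathcomp Require Import reals complex ring lra.

(** The module is a product of three factors.  The deviations are orthogonal
    to xi, so a_perp x b_perp is parallel to xi and
    |a_perp x b_perp| |xi| = |det (Re nu, Im nu, xi)|; hence
    m(s) = T |xi| / (2 |det (Re nu, Im nu, xi)|) (conf_moduleE).  A V-move is
    unimodular, so the determinant does not change (volume_Vmove), and only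
    T |xi| has to be compared before and after the move.

    The move with g = 0 suffices.  Take for A and B the quotients of x_1 and
    x_2 by x_3, rounded so that the remainders lie in ]0, x_3]: the candidate
    is in the window and its real coordinates are at most x_3, while
    |xi| >= x_1 = r x_3.  So |xi| shrinks by a factor r / 2 at least.

    Meanwhile T stays bounded (devT_Vmove0_le).  It is the minimum over zeta of
    the sum of the |sigma_c(u_i) - zeta x_i|^2 (devT_le_offset), so the value
    of zeta optimal for s gives an upper bound for the candidate, in which
    the deviations are w_1 - A w_3, w_2 - B w_3 and w_3.  As A and B are at
    most r, the hypothesis on w_3 gives |A w_3|, |B w_3| <= sqrt T, and the
    new sum is at most 6 T.  The module is therefore divided by r / 12 at
    least, and 12 <= 21.2. *)

Set Implicit Arguments.
Unset Strict Implicit.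

Import Order.TTheory GRing.Theory Num.Theory.

Local Open Scope ring_scope.
Local Open Scope complex_scope.

(** * Vectors with three coordinates *)

Section Vectors3.
Variable R : realType.
Implicit Types u v w : 'rV[R]_3.

Lemma sum_ord3 (S : nmodType) (F : 'I_3 -> S) :
  \sum_(k < 3) F k = F 0 + F 1 + F 2.
Proof.
rewrite !big_ord_recl big_ord0 addr0 addrA.
by congr (_ + F _ + F _); apply: val_inj.
Qed.

Lemma forall_ord3 (P : 'I_3 -> Prop) :
  P 0 -> P 1 -> P 2 -> forall k, P k.
Proof.
move=> P0 P1 P2 [[|[|[|//]]] lt_k3].
- by rewrite (_ : Ordinal _ = 0)//; apply: val_inj.
- by rewrite (_ : Ordinal _ = 1)//; apply: val_inj.
- by rewrite (_ : Ordinal _ = 2)//; apply: val_inj.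
Qed.

Lemma dot3E (S : pzRingType) (u v : 'rV[S]_3) :
  dot u v = u 0 0 * v 0 0 + u 0 1 * v 0 1 + u 0 2 * v 0 2.
Proof. exact: sum_ord3. Qed.

Lemma cross3E (S : pzRingType) (u v : 'rV[S]_3) :
  [/\ cross u v 0 0 = u 0 1 * v 0 2 - u 0 2 * v 0 1,
      cross u v 0 1 = u 0 2 * v 0 0 - u 0 0 * v 0 2
    & cross u v 0 2 = u 0 0 * v 0 1 - u 0 1 * v 0 0].
Proof.
by split; rewrite mxE; congr (_ * _ - _ * _); congr (_ 0 _); apply: val_inj.
Qed.

Lemma dot_cross3E (S : pzRingType) (u v w : 'rV[S]_3) :
  dot (cross u v) w = (u 0 1 * v 0 2 - u 0 2 * v 0 1) * w 0 0
    + (u 0 2 * v 0 0 - u 0 0 * v 0 2) * w 0 1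
    + (u 0 0 * v 0 1 - u 0 1 * v 0 0) * w 0 2.
Proof. by rewrite dot3E; have [-> -> ->] := cross3E u v. Qed.

Lemma enorm_ge0 u : 0 <= enorm u.
Proof. exact: sqrtr_ge0. Qed.

Lemma dot_ge0 u : 0 <= dot u u.
Proof. by apply: sumr_ge0 => i _; rewrite -expr2 sqr_ge0. Qed.

Lemma sqr_enorm u : enorm u ^+ 2 = dot u u.
Proof. by rewrite sqr_sqrtr ?dot_ge0. Qed.

Lemma dot_cross_Lagrange u v :
  dot (cross u v) (cross u v) = dot u u * dot v v - dot u v ^+ 2.
Proof.
by rewrite !dot3E; have [-> -> ->] := cross3E u v; ring.
Qed.

(** |(u x v) x w| = |(w.u) v - (w.v) u| = 0 here, so u x v and w are parallel
    and Cauchy-Schwarz is an equality. *)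
Lemma enorm_cross_orthogonal u v w : dot u w = 0 -> dot v w = 0 ->
  enorm (cross u v) * enorm w = `|dot (cross u v) w|.
Proof.
move=> uw0 vw0; rewrite -sqrtrM ?dot_ge0// -sqrtr_sqr; congr Num.sqrt.
(* The general identity: both sides are |(u x v) x w|^2. *)
suff: dot (cross u v) (cross u v) * dot w w - dot (cross u v) w ^+ 2
      = dot u w ^+ 2 * dot v v + dot v w ^+ 2 * dot u u
        - 2 * dot u w * dot v w * dot u v.
  by rewrite uw0 vw0 => e; apply/eqP; rewrite -subr_eq0 e; apply/eqP; ring.
by rewrite !dot3E; have [-> -> ->] := cross3E u v; ring.
Qed.

Lemma dot_perm (S : pzRingType) (p : 'S_3) (u v u' v' : 'rV[S]_3) :
    (forall k, u 0 k = u' 0 (p k)) -> (forall k, v 0 k = v' 0 (p k)) ->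
  dot u v = dot u' v'.
Proof.
move=> uE vE; rewrite /dot [RHS](reindex_inj (@perm_inj _ p)) /=.
by apply: eq_bigr => k _; rewrite uE vE.
Qed.

(** The vector cross u v is permuted only up to sign; by the Lagrange identity
    its norm depends on dot products alone. *)
Lemma enorm_cross_perm (p : 'S_3) (u v u' v' : 'rV[R]_3) :
    (forall k, u 0 k = u' 0 (p k)) -> (forall k, v 0 k = v' 0 (p k)) ->
  enorm (cross u v) = enorm (cross u' v').
Proof.
move=> uE vE; rewrite /enorm !dot_cross_Lagrange.
by rewrite (dot_perm uE uE) (dot_perm vE vE) (dot_perm uE vE).
Qed.

End Vectors3.

Lemma tnth_Vmove (K : fieldExtType rat) (A B g : nat) (s : 3.-tuple K) :
  let u2' := tnth s 1 - B%:R * tnth s 2 in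
  [/\ tnth (Vmove A B g s) 0 = tnth s 0 - g%:R * u2' - A%:R * tnth s 2,
      tnth (Vmove A B g s) 1 = u2'
    & tnth (Vmove A B g s) 2 = tnth s 2].
Proof. by []. Qed.

(** * The conformal module *)

Section ConformalModule.
Variables (R : realType) (K : fieldExtType rat).
Variables (sr : {rmorphism K -> R}) (sc : {rmorphism K -> R[i]}).
Implicit Types (s t : 3.-tuple K) (z : R[i]).

(** The deviation of u measured from an arbitrary zeta: for fixed z it is
    additive in u, which dev is not, since zetabar changes with the state. *)
Definition offset z (u : K) : R[i] := sc u - z * (sr u)%:C.

Definition volume s : R :=
  dot (cross (map_mx (fun z : R[i] => complex.Re z) (nu sc s))
             (map_mx (fun z : R[i] => complex.Im z) (nu sc s)))
      (xi sr s).

Lemma sqr_normc z :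
  Normc.normc z ^+ 2 = complex.Re z ^+ 2 + complex.Im z ^+ 2.
Proof. by case: z => a b /=; rewrite sqr_sqrtr// addr_ge0 ?sqr_ge0. Qed.

Lemma normc_nonneg z : 0 <= Normc.normc z.
Proof. by case: z => a b; apply: sqrtr_ge0. Qed.

Lemma sqr_normcB_le z z' :
  Normc.normc (z - z') ^+ 2
  <= 2 * (Normc.normc z ^+ 2 + Normc.normc z' ^+ 2).
Proof.
rewrite !sqr_normc; case: z z' => a b [c d] /=.
have := sqr_ge0 (a + c); have := sqr_ge0 (b + d); nra.
Qed.

Lemma sqr_normc_nat (n : nat) z :
  Normc.normc (n%:R * z) ^+ 2 = (n%:R * Normc.normc z) ^+ 2.
Proof.
rewrite exprMn -(rmorph_nat (real_complex R)) !sqr_normc.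
by case: z => a b /=; ring.
Qed.

Lemma offsetB z : {morph offset z : u v / u - v}.
Proof. by move=> u v; rewrite /offset !rmorphB /=; ring. Qed.

Lemma offset_nat z (n : nat) u : offset z (n%:R * u) = n%:R * offset z u.
Proof. by rewrite /offset !rmorphM !rmorph_nat /=; ring. Qed.

Lemma devE s k : dev sr sc s 0 k = offset (zetabar sr sc s) (tnth s k).
Proof. by rewrite !mxE. Qed.

Lemma enorm_xi_gt0 s : in_window sr s -> 0 < enorm (xi sr s).
Proof.
move=> s_gt0; rewrite sqrtr_gt0 dot3E !mxE.
by rewrite !addr_gt0 ?mulr_gt0.
Qed.

Lemma dot_dev_xi s : in_window sr s -> dot (dev sr sc s) (xiC sr s) = 0.
Proof.
move=> s_gt0; have n_gt0 := enorm_xi_gt0 s_gt0.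
have nE : dot (xiC sr s) (xiC sr s) = (enorm (xi sr s) ^+ 2)%:C.
  by rewrite sqr_enorm !dot3E !mxE !rmorphD !rmorphM.
have -> : dot (dev sr sc s) (xiC sr s)
   = dot (xiC sr s) (nu sc s) - zetabar sr sc s * dot (xiC sr s) (xiC sr s).
  by rewrite !dot3E !mxE; ring.
rewrite nE /zetabar divfK ?subrr//.
by rewrite fmorph_eq0 expf_neq0// gt_eqF.
Qed.

Lemma dot_realC (w : 'rV[R[i]]_3) (x : 'rV[R]_3) :
  dot w (map_mx (fun a : R => a%:C) x)
  = dot (map_mx (fun z : R[i] => complex.Re z) w) x
    +i* dot (map_mx (fun z : R[i] => complex.Im z) w) x.
Proof.
rewrite !dot3E !mxE.
case: (w 0 0) (w 0 1) (w 0 2) => a b [c d] [e f]; apply/eqP.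
by rewrite eq_complex /=; apply/andP; split; apply/eqP; ring.
Qed.

Lemma dot_perp_xi s : in_window sr s ->
  dot (a_perp sr sc s) (xi sr s) = 0 /\ dot (b_perp sr sc s) (xi sr s) = 0.
Proof.
by move=> /dot_dev_xi; rewrite /xiC dot_realC => /eqP;
  rewrite eq_complex => /andP[/eqP ? /eqP ?].
Qed.

Lemma devT_ge0 s : 0 <= devT sr sc s.
Proof. by apply: sumr_ge0 => k _; apply: sqr_ge0. Qed.

(** zetabar is the least-squares slope: passing to another z adds a multiple
    of xi, which is orthogonal to the deviations (Pythagoras). *)
Lemma devT_le_offset s z : in_window sr s ->
  devT sr sc s <= \sum_(k < 3) Normc.normc (offset z (tnth s k)) ^+ 2.
Proof.
move=> s_gt0; have [aP bP] := dot_perp_xi s_gt0.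
have [p [q zE]] : exists p q : R, zetabar sr sc s - z = p +i* q.
  by case: (_ - _) => p q; exists p, q.
have offE k : offset z (tnth s k)
    = dev sr sc s 0 k + (p +i* q) * (xi sr s 0 k)%:C.
  by rewrite -zE devE /offset mxE; ring.
have -> : \sum_(k < 3) Normc.normc (offset z (tnth s k)) ^+ 2
    = devT sr sc s + 2 * p * dot (a_perp sr sc s) (xi sr s)
      + 2 * q * dot (b_perp sr sc s) (xi sr s)
      + (p ^+ 2 + q ^+ 2) * dot (xi sr s) (xi sr s).
  rewrite /devT /dot !mulr_sumr -!big_split /=; apply: eq_bigr => k _.
  rewrite offE !sqr_normc [a_perp _ _ _ 0 k]mxE [b_perp _ _ _ 0 k]mxE.
  by case: (dev sr sc s 0 k) => a b /=; ring.
rewrite aP bP !mulr0 !addr0 lerDl mulr_ge0 ?dot_ge0//.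
by rewrite addr_ge0 ?sqr_ge0.
Qed.

(** Subtracting a real multiple of xi from Re nu or Im nu leaves the
    determinant unchanged. *)
Lemma volume_perp s :
  dot (cross (a_perp sr sc s) (b_perp sr sc s)) (xi sr s) = volume s.
Proof.
rewrite /volume !dot_cross3E.
rewrite !mxE; case: (zetabar sr sc s) => p q.
by case: (sc _) => a b; case: (sc _) => c d; case: (sc _) => e f /=; ring.
Qed.

(** Separates the factor volume, invariant under moves, from T and |xi|.  It
    also holds when the volume is 0, both quotients being then 0. *)
Lemma conf_moduleE s : in_window sr s ->
  conf_module sr sc s = devT sr sc s * enorm (xi sr s) / (2 * `|volume s|).
Proof.
move=> s_gt0; have [aP bP] := dot_perp_xi s_gt0.
have n_gt0 := enorm_xi_gt0 s_gt0.
rewrite -volume_perp -enorm_cross_orthogonal// /conf_module.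
by rewrite mulrA -mulf_div divff ?mulr1 ?gt_eqF.
Qed.

Lemma volume_Vmove A B g s : volume (Vmove A B g s) = volume s.
Proof.
rewrite /volume !dot_cross3E.
have natE (n : nat) : n%:R = n%:R%:C :> R[i] by rewrite rmorph_nat.
rewrite !mxE; have [-> -> ->] := tnth_Vmove A B g s.
rewrite !(rmorphB, rmorphM, rmorph_nat) !natE.
move: (A%:R : R) (B%:R : R) (g%:R : R) => a0 b0 g0.
move: (sr _) (sr _) (sr _) => x y z.
by move: (sc _) (sc _) (sc _) => [a b] [c d] [e f] /=; ring.
Qed.

(** With the zeta of s kept for the moved triple, the deviations become
    w_1 - A w_3, w_2 - B w_3 and w_3, and |A w_3|^2, |B w_3|^2 <= T; then
    |w - w'|^2 <= 2 |w|^2 + 2 |w'|^2 gives 2 T + 4 T. *)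
Lemma devT_Vmove0_le (A B : nat) (r : R) s : 0 < r ->
    A%:R <= r -> B%:R <= r -> in_window sr (Vmove A B 0 s) ->
    Normc.normc (dev sr sc s 0 2) <= Num.sqrt (devT sr sc s) / r ->
  devT sr sc (Vmove A B 0 s) <= 6 * devT sr sc s.
Proof.
move=> r_gt0 le_Ar le_Br V_gt0 w3_le.
have normw3_le (n : nat) : n%:R <= r ->
    (n%:R * Normc.normc (dev sr sc s 0 2)) ^+ 2 <= devT sr sc s.
  move=> le_nr; rewrite -[leRHS](sqr_sqrtr (devT_ge0 s)).
  rewrite ler_pXn2r ?nnegrE ?sqrtr_ge0 ?mulr_ge0 ?ler0n ?normc_nonneg//.
  rewrite -[leRHS](divfK (lt0r_neq0 r_gt0)) mulrC.
  by rewrite ler_pM ?ler0n ?normc_nonneg.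
apply: le_trans (devT_le_offset (zetabar sr sc s) V_gt0) _.
have [V0 V1 V2] := tnth_Vmove A B 0 s; rewrite mul0r subr0 in V0.
rewrite sum_ord3 V0 V1 V2 !offsetB !offset_nat -!devE.
have TE : devT sr sc s = Normc.normc (dev sr sc s 0 0) ^+ 2
    + Normc.normc (dev sr sc s 0 1) ^+ 2
    + Normc.normc (dev sr sc s 0 2) ^+ 2 by exact: sum_ord3.
have normA := sqr_normcB_le (dev sr sc s 0 0) (A%:R * dev sr sc s 0 2).
have normB := sqr_normcB_le (dev sr sc s 0 1) (B%:R * dev sr sc s 0 2).
have := normw3_le _ le_Ar; have := normw3_le _ le_Br.
have := sqr_ge0 (Normc.normc (dev sr sc s 0 0)).
have := sqr_ge0 (Normc.normc (dev sr sc s 0 1)).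
have := sqr_ge0 (Normc.normc (dev sr sc s 0 2)).
move: normA normB TE; rewrite !sqr_normc_nat; lra.
Qed.

Lemma conf_module_perm s t : perm_eq s t ->
  conf_module sr sc s = conf_module sr sc t.
Proof.
move=> /tuple_permP[p /val_inj sE].
have tnthE k : tnth s k = tnth t (p k) by rewrite sE tnth_mktuple.
have xE k : xi sr s 0 k = xi sr t 0 (p k) by rewrite !mxE tnthE.
have zE : zetabar sr sc s = zetabar sr sc t.
  rewrite /zetabar !sqr_enorm (dot_perm xE xE); congr (_ / _).
  by apply: (dot_perm (p := p)) => k; rewrite !mxE tnthE.
have dE k : dev sr sc s 0 k = dev sr sc t 0 (p k).
  by rewrite [LHS]devE [RHS]devE zE tnthE.
have aE k : a_perp sr sc s 0 k = a_perp sr sc t 0 (p k).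
  by rewrite [LHS]mxE [RHS]mxE; congr complex.Re; exact: dE.
have bE k : b_perp sr sc s 0 k = b_perp sr sc t 0 (p k).
  by rewrite [LHS]mxE [RHS]mxE; congr complex.Im; exact: dE.
have TE : devT sr sc s = devT sr sc t.
  rewrite /devT [RHS](reindex_inj (@perm_inj _ p)) /=.
  by apply: eq_bigr => k _; congr (Normc.normc _ ^+ 2); apply: dE.
have NE := enorm_cross_perm aE bE.
exact: (f_equal2 (fun T N : R => T / (2 * N)) TE NE).
Qed.

End ConformalModule.

(** * Candidates are states *)

Section Candidates.
Variables (R : realType) (K : fieldExtType rat) (sr : {rmorphism K -> R}).
Implicit Types (s t : 3.-tuple K).

(** The move is invertible over the integers, so the old generators are in
    the span of the new ones. *)
Lemma basis_Vmove A B g s :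
  basis_of {:K} s -> basis_of {:K} (Vmove A B g s).
Proof.
move=> s_basis; have dimK := size_basis s_basis.
have /andP[/eqP sK _] := s_basis.
rewrite basisEdim size_tuple dimK leqnn andbT -sK.
have [] := tnth_Vmove A B g s; set V := Vmove A B g s => V0 V1 V2.
have: forall k, tnth V k \in <<V>>%VS by move=> k; rewrite memv_span ?mem_tnth.
move: <<V>>%VS => W VW; have := VW 2; have := VW 1; have := VW 0.
rewrite V0 V1 V2; set u2' := _ - _ => u1'W u2'W u3W.
have natW (n : nat) u : u \in W -> n%:R * u \in W.
  by rewrite mulr_natl; apply: rpredMn.
apply/span_subvP => _ /tnthP[k ->]; move: k; apply: forall_ord3 => //.
- rewrite -(rpredBr (tnth s 0) (natW g _ u2'W)).
  by rewrite -(rpredBr (_ - _) (natW A _ u3W)).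
by rewrite -(rpredBr (tnth s 1) (natW B _ u3W)).
Qed.

Lemma mem_Vmove (L : {pred K}) A B g s k : is_order L ->
  (forall k, tnth s k \in L) -> tnth (Vmove A B g s) k \in L.
Proof.
case=> [[L1 LB LM] _ _] sL.
have Lnat (n : nat) : n%:R \in L.
  elim: n => [|n IHn]; first by rewrite mulr0n -(subrr 1) LB.
  rewrite (_ : n.+1%:R = n%:R - (1 - 1 - 1)) ?LB//.
  by rewrite subrr sub0r opprK mulrSr.
have [V0 V1 V2] := tnth_Vmove A B g s.
have natL (n : nat) u : u \in L -> n%:R * u \in L := LM _ _ (Lnat n).
have u2'L := LB _ _ (sL 1) (natL B _ (sL 2)).
move: k; apply: forall_ord3; rewrite ?V0 ?V1 ?V2 //.
exact: LB _ _ (LB _ _ (sL 0) (natL g _ u2'L)) (natL A _ (sL 2)).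
Qed.

Lemma sorted_candidate (L : {pred K}) A B g s :
  is_order L -> is_state sr L s ->
  in_window sr (Vmove A B g s) ->
  exists2 t, V_candidate sr L s t & perm_eq t (Vmove A B g s).
Proof.
move=> ordL [sL s_basis _ _] Vwin; set V := Vmove A B g s in Vwin *.
pose e := [rel u v : K | sr v <= sr u].
have permV : perm_eq (sort_tuple e V) V by rewrite perm_sort.
have memV k : exists l, tnth (sort_tuple e V) k = tnth V l.
  by apply/tnthP; rewrite -(perm_mem permV) mem_tnth.
exists (sort_tuple e V) => //; exists A, B, g; split=> //; split.
- by move=> k; have [l ->] := memV k; apply: mem_Vmove.
- by rewrite (perm_basis _ permV) basis_Vmove.
- by move=> k; have [l ->] := memV k.
move=> i j le_ij; rewrite !(tnth_nth 0).
have /= := @sorted_leq_nth _ e _ _ 0 (sort e V) _ i j.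
rewrite !inE size_sort size_tuple !ltn_ord; apply=> //.
- by move=> u v w /= le1 le2; apply: le_trans le2 le1.
- by move=> u /=.
- by apply: sort_sorted => u v /=; apply: le_total.
Qed.

End Candidates.

(** * The reduction step *)

(** Rounding x / y up instead of down keeps the remainder positive even when
    y divides x. *)
Lemma exists_nat_remainder (R : realType) (x y : R) : 0 < x -> 0 < y ->
  exists n : nat, 0 < x - n%:R * y <= y.
Proof.
move=> x_gt0 y_gt0.
have ex_n : exists n : nat, x <= n.+1%:R * y.
  exists (Num.truncn (x / y)); rewrite -ler_pdivrMr//.
  by rewrite ltW// truncnS_gt.
have [n le_xn minn] := ex_minnP ex_n; exists n; apply/andP; split.
  case: n le_xn minn => [|n] _ minn; first by rewrite mul0r subr0.
  by rewrite subr_gt0 ltNge; apply/negP => /minn; rewrite ltnn.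
by rewrite lerBlDl; move: le_xn; rewrite mulrSr mulrDl mul1r.
Qed.

(** The numerical comparison, with T, n standing for the state and T', n' for
    its candidate; the product of the bounds is 12 T n / r. *)
Lemma product_le_div (R : realType) (T T' n n' x r : R) :
    0 <= T' -> 0 <= T -> 0 <= n' -> 0 < r ->
    T' <= 6 * T -> n' <= 2 * x -> r * x <= n ->
  T' * n' <= 212 / 10 * (T * n / r).
Proof.
move=> T'_ge0 T_ge0 n'_ge0 r_gt0 leT len lex; rewrite mulrA ler_pdivlMr//.
apply: le_trans (ler_wpM2r (ltW r_gt0) (ler_pM T'_ge0 n'_ge0 leT len)) _.
have rx_ge0 : 0 <= r * x by rewrite mulr_ge0 ?(ltW r_gt0)//; lra.
have := ler_wpM2l T_ge0 lex; have := mulr_ge0 T_ge0 rx_ge0; lra.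
Qed.

Unset Implicit Arguments.

Theorem lemma6p1 (R : realType) (K : fieldExtType rat)
  (dimK : \dim {:K} = 3%N) (sigK : has_signature R K 1 1)
  (sr : {rmorphism K -> R}) (sc : {rmorphism K -> R[i]}) (sc_nonreal : nonreal sc)
  (L : {pred K}) (ordL : is_order L)
  (m0 Lam : R) (m0_ge1 : 1 <= m0) (Lam_ge1 : 1 <= Lam)
  (s : 3.-tuple K) (state_s : is_state sr L s)
  (m : R) (m_def : m = conf_module sr sc s) (m_ge : m0 <= m)
  (r : R) (r_def : r = sr (tnth s 0) / sr (tnth s 2)) (r_ge : Lam <= r)
  (w3_le : Normc.normc (dev sr sc s 0 2) <= Num.sqrt (devT sr sc s) / r) :
  exists s' : 3.-tuple K,
    [/\ V_candidate sr L s s',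
        conf_module sr sc s' <= 212 / 10 * (m / r)
      & forall gamma : R, 1 < gamma -> 212 / 10 * gamma <= r ->
          conf_module sr sc s' <= m / gamma].
Proof.
have [_ _ s_gt0 s_sorted] := state_s.
set x1 := sr (tnth s 0) in r_def; set x3 := sr (tnth s 2) in r_def.
set x2 := sr (tnth s 1).
have x1_gt0 : 0 < x1 by exact: s_gt0.
have x2_gt0 : 0 < x2 by exact: s_gt0.
have x3_gt0 : 0 < x3 by exact: s_gt0.
have x2_le : x2 <= x1 by exact: s_sorted.
have r_gt0 : 0 < r by rewrite r_def divr_gt0.
have x1E : x1 = r * x3 by rewrite r_def divfK// gt_eqF.
have [A /andP[A_gt0 A_le]] := exists_nat_remainder x1_gt0 x3_gt0.
have [B /andP[B_gt0 B_le]] := exists_nat_remainder x2_gt0 x3_gt0.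
have le_Ar : A%:R <= r.
  by rewrite -(ler_pM2r x3_gt0) -x1E -subr_ge0 ltW.
have le_Br : B%:R <= r.
  by rewrite -(ler_pM2r x3_gt0) -x1E (le_trans _ x2_le)// -subr_ge0 ltW.
pose V := Vmove A B 0 s.
have [V0 V1 V2] := tnth_Vmove A B 0 s; rewrite -/V in V0 V1 V2.
rewrite mul0r subr0 in V0.
have xV0 : sr (tnth V 0) = x1 - A%:R * x3.
  by rewrite V0 rmorphB rmorphM rmorph_nat.
have xV1 : sr (tnth V 1) = x2 - B%:R * x3.
  by rewrite V1 rmorphB rmorphM rmorph_nat.
have xV2 : sr (tnth V 2) = x3 by rewrite V2.
have V_gt0 : in_window sr V by apply: forall_ord3; rewrite ?xV0 ?xV1 ?xV2.
have [t t_cand permtV] := sorted_candidate ordL state_s V_gt0.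
(* The three coordinates are at most x3, so |xi'|^2 <= 3 x3^2 <= (2 x3)^2. *)
have xiV_le : enorm (xi sr V) <= 2 * x3.
  rewrite -(ler_pXn2r (ltn0Sn 1)) ?nnegrE ?enorm_ge0 ?mulr_ge0 ?ltW//.
  rewrite sqr_enorm dot3E !mxE xV0 xV1 xV2; nra.
have xi_ge : r * x3 <= enorm (xi sr s).
  rewrite -x1E -(ler_pXn2r (ltn0Sn 1)) ?nnegrE ?enorm_ge0 ?ltW//.
  by rewrite sqr_enorm dot3E !mxE -/x1 -/x2 -/x3; nra.
have T_ge0 : 0 <= devT sr sc s by exact: devT_ge0.
have TV_le : devT sr sc V <= 6 * devT sr sc s by exact: (devT_Vmove0_le r_gt0).
have m_ge0 : 0 <= m by rewrite (le_trans _ m_ge)// (le_trans _ m0_ge1).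
have le_m : conf_module sr sc t <= 212 / 10 * (m / r).
  rewrite (conf_module_perm _ _ permtV) m_def !conf_moduleE//.
  rewrite volume_Vmove.
  have := product_le_div (devT_ge0 sr sc V) T_ge0 (enorm_ge0 _) r_gt0 TV_le
    xiV_le xi_ge.
  have vol_ge0 : 0 <= (2 * `|volume sr sc s|)^-1 by rewrite invr_ge0 mulr_ge0.
  move=> /(ler_wpM2r vol_ge0) /le_trans; apply.
  by rewrite -!mulrA [r^-1 * _]mulrC.
exists t; split=> // gamma gamma_gt1 le_r; apply: le_trans le_m _.
have gamma_gt0 : 0 < gamma by rewrite (lt_trans _ gamma_gt1).
have -> : 212 / 10 * (m / r) = 212 / 10 * m / r by rewrite mulrA.
rewrite ler_pdivrMr// [leRHS]mulrAC ler_pdivlMr// (mulrC _ m) -mulrA.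
exact: ler_wpM2l.
Qed.
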